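(* For every constant $\varepsilon>0$, there exists a constant $c>1$ such that for every large enough $n$ there exists a function $\mathsf{anmExt}:\{0,1\}^n\to\{0,1\}$ such that for any affine source $X$ on $\{0,1\}^n$ of entropy at least $k\ge c\log n$ and any affine function $\mathcal{A}:\{0,1\}^n\to\{0,1\}^n$ without fixed points, it holds that $(\mathsf{anmExt}(X),\mathsf{anmExt}(\mathcal{A}(X)))\approx_\varepsilon (U_1,\mathsf{anmExt}(\mathcal{A}(X))).$
   Context: An affine source on $\{0,1\}^n=\mathbb{F}_2^n$ is the uniform distribution over an affine subspace of $\mathbb{F}_2^n$; its (min-)entropy is the dimension of that subspace. An affine function is a map $x\mapsto Mx+b$ over $\mathbb{F}_2$; it has no fixed points if $\mathcal{A}(x)\ne x$ for all $x$. $U_1$ is a uniform bit independent of $X$, and $A\approx_\varepsilon B$ means the statistical distance between $A$ and $B$ is at most $\varepsilon$. *)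

(* Defs.v *)
From mathcomp Require Import all_boot all_order all_algebra.
From mathcomp Require Import reals exp.

Set Implicit Arguments.
Unset Strict Implicit.
Unset Printing Implicit Defensive.

Import Order.TTheory GRing.Theory Num.Theory.
Local Open Scope ring_scope.

Record dist (R : realType) (T : finType) := Dist {
  pmf :> T -> R;
  pmf_ge0 : forall x, 0 <= pmf x;
  pmf_sum1 : \sum_x pmf x = 1 }.

Section Distributions.
Variable R : realType.

Section Map.
Variables (S T : finType) (f : S -> T) (P : dist R S).

Definition dmap_pmf (y : T) : R := \sum_(x | f x == y) P x.

Lemma dmap_ge0 y : 0 <= dmap_pmf y.
Proof. by apply: sumr_ge0 => x _; apply: pmf_ge0. Qed.

Lemma dmap_sum1 : \sum_y dmap_pmf y = 1.
Proof. by rewrite -(pmf_sum1 P) (partition_big f predT). Qed.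

Definition dmap : dist R T := Dist dmap_ge0 dmap_sum1.
End Map.

Section Prod.
Variables (S T : finType) (P : dist R S) (Q : dist R T).

Definition dprod_pmf (z : S * T) : R := P z.1 * Q z.2.

Lemma dprod_ge0 z : 0 <= dprod_pmf z.
Proof. by apply: mulr_ge0; apply: pmf_ge0. Qed.

Lemma dprod_sum1 : \sum_z dprod_pmf z = 1.
Proof.
rewrite -(pair_bigA _ (fun x y => P x * Q y)) /=.
rewrite -[RHS](pmf_sum1 P); apply: eq_bigr => x _.
by rewrite -mulr_sumr pmf_sum1 mulr1.
Qed.

Definition dprod : dist R (S * T)%type := Dist dprod_ge0 dprod_sum1.
End Prod.

Definition unif_bit_pmf (_ : 'F_2) : R := 2^-1.

Lemma unif_bit_ge0 b : 0 <= unif_bit_pmf b.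
Proof. by rewrite /unif_bit_pmf invr_ge0 ler0n. Qed.

Lemma unif_bit_sum1 : \sum_b unif_bit_pmf b = 1.
Proof.
by rewrite /unif_bit_pmf sumr_const card_Fp // -[LHS]mulr_natr mulVf // pnatr_eq0.
Qed.

Definition unif_bit : dist R 'F_2 := Dist unif_bit_ge0 unif_bit_sum1.

Definition uniform_over (T : finType) (P : dist R T) (A : {set T}) : Prop :=
  forall x, P x = if x \in A then #|A|%:R^-1 else 0.

Definition stat_dist (T : finType) (P Q : dist R T) : R :=
  2^-1 * \sum_x `|P x - Q x|.

Definition log2 (x : R) : R := ln x / ln 2.

End Distributions.

Section Affine.
Variable n : nat.

Definition affine_subspace (a : 'cV['F_2]_n) (V : {vspace 'cV['F_2]_n}) :
  {set 'cV['F_2]_n} := [set a + v | v in V].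

(* The entropy of an affine source is the dimension d of its support. *)
Definition affine_source (R : realType) (X : dist R 'cV['F_2]_n) (d : nat) :
    Prop :=
  exists (a : 'cV['F_2]_n) (V : {vspace 'cV['F_2]_n}),
    \dim V = d /\ uniform_over X (affine_subspace a V).

Definition affine_fun (A : 'cV['F_2]_n -> 'cV['F_2]_n) : Prop :=
  exists (M : 'M['F_2]_n) (b : 'cV['F_2]_n), forall x, A x = M *m x + b.

End Affine.

(* Main.v *)
(* Probabilistic method.  By the XOR lemma it suffices that the signs
   chi = (-1)^anmExt have small mean bias of chi(x) and of chi(x) chi(A x) over
   every large affine subspace S.  An affine map A without fixed points admits
   a linear functional phi with phi(A x) = phi(x) + 1, so on each half
   {x in S | phi x = tau} the factor chi(A x) only involves values of chi
   outside that half, and the sum behaves like one of independent signs.  A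
   Chernoff bound makes each bias large with probability at most
   2^-Omega(#|S|), and a union bound over the 2^O(n^2) pairs (S, A) succeeds as
   soon as #|S| >= n^4 with n large. *)
Require Import Defs.
From mathcomp Require Import all_boot all_order all_algebra finfield.
From mathcomp Require Import reals exp.
From mathcomp Require Import zify ring lra.

Import Order.TTheory GRing.Theory Num.Theory.
Local Open Scope ring_scope.

(** * Random signs: exponential moments and the union bound *)

Section RandomSigns.
Variables (R : realType) (T : finType).
Implicit Types (f : {ffun T -> bool}) (D : {set T}).

Definition flip (x0 : T) (f : {ffun T -> bool}) : {ffun T -> bool} :=
  [ffun x => f x (+) (x == x0)].

Lemma flipK x0 : involutive (flip x0).
Proof. by move=> f; apply/ffunP => x; rewrite !ffunE -addbA addbb addbF. Qed.

(** Flipping [f] at a point [x0] of [D] negates the sign at [x0] and preserves the other factors,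
    because [g] on [D] ignores the values of [f] on [D]. The terms in [t] at [x0] therefore cancel
    in pairs, and the points are removed one by one, as if the signs were independent. *)
Lemma sum_prod_signs (t : R) D (g : {ffun T -> bool} -> T -> bool) :
  {in D, forall x0 f, {in D, g (flip x0 f) =1 g f}} ->
  \sum_(f : {ffun T -> bool})
    \prod_(x in D) (1 + t * (-1) ^+ (f x (+) g f x)) =
  #|{ffun T -> bool}|%:R.
Proof.
move=> gD.
suff IH : forall m (E : {set T}), E \subset D -> #|E| = m ->
    \sum_(f : {ffun T -> bool})
      \prod_(x in E) (1 + t * (-1) ^+ (f x (+) g f x)) =
    #|{ffun T -> bool}|%:R :> R by apply: IH.
elim=> [|m IH] E sED cardE.
  move/eqP: cardE; rewrite cards_eq0 => /eqP ->.
  under eq_bigr => f _ do rewrite big_set0.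
  by rewrite sumr_const cardT.
have /card_gt0P[x0 x0E] : (0 < #|E|)%N by rewrite cardE.
have x0D := subsetP sED _ x0E.
have sED' : E :\ x0 \subset D by apply: subset_trans sED; apply: subD1set.
have cardE' : #|E :\ x0| = m by move: cardE; rewrite (cardsD1 x0) x0E => -[].
rewrite -(IH _ sED' cardE').
set F := fun f => \prod_(x in E :\ x0) (1 + t * (-1) ^+ (f x (+) g f x)) : R.
have Fflip f : F (flip x0 f) = F f.
  apply: eq_bigr => x; rewrite !inE => /andP[xx0 xE].
  by rewrite (gD _ x0D) ?(subsetP sED) // ffunE (negbTE xx0) addbF.
under eq_bigr => f _ do rewrite (big_setD1 x0) //= -/(F f).
set u := fun f => t * (-1) ^+ (f x0 (+) g f x0) : R.
have uflip f : u (flip x0 f) = - u f.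
  rewrite /u (gD _ x0D) // ffunE eqxx.
  by case: (f x0); case: (g f x0); rewrite /= ?expr1 ?expr0; ring.
under eq_bigr => f _ do rewrite mulrDl mul1r -/(u f).
rewrite big_split /=; suff -> : \sum_(f : {ffun T -> bool}) u f * F f = 0 by rewrite addr0.
have E0 : \sum_(f : {ffun T -> bool}) u f * F f = - \sum_(f : {ffun T -> bool}) u f * F f.
  rewrite [LHS](reindex_inj (inv_inj (flipK x0))) -sumrN.
  by apply: eq_bigr => f _; rewrite Fflip uflip mulNr.
lra.
Qed.

Lemma prod_signs D (t : R) (u : T -> bool) :
  \prod_(x in D) (1 + t * (-1) ^+ u x) =
  (1 + t) ^+ #|[set x in D | ~~ u x]| * (1 - t) ^+ #|[set x in D | u x]|.
Proof.
rewrite (bigID u) /= mulrC; congr (_ * _).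
  rewrite (eq_bigr (fun=> 1 + t)); last first.
    by move=> x /andP[_ /negbTE ->]; rewrite expr0 mulr1.
  by rewrite prodr_const; congr (_ ^+ _); apply: eq_card => x; rewrite !inE.
rewrite (eq_bigr (fun=> 1 - t)); last first.
  by move=> x /andP[_ ->]; rewrite expr1 mulrN1.
by rewrite prodr_const; congr (_ ^+ _); apply: eq_card => x; rewrite !inE.
Qed.

Lemma sum_signs D (u : T -> bool) :
  \sum_(x in D) (-1) ^+ u x =
  #|[set x in D | ~~ u x]|%:R - #|[set x in D | u x]|%:R :> R.
Proof.
rewrite (bigID u) /= addrC; congr (_ + _).
  rewrite (eq_bigr (fun=> 1)); last first.
    by move=> x /andP[_ /negbTE ->].
  by rewrite sumr_const; congr (_ %:R); apply: eq_card => x; rewrite !inE.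
rewrite (eq_bigr (fun=> - 1)); last by move=> x /andP[_ ->].
by rewrite sumr_const mulNrn; congr (- _ %:R); apply: eq_card => x; rewrite !inE.
Qed.

Lemma bernoulli (x : R) m : -1 <= x -> 1 + x *+ m <= (1 + x) ^+ m.
Proof.
move=> x_ge; elim: m => [|m IH]; first by rewrite mulr0n addr0 expr0.
rewrite exprS; apply: le_trans (ler_wpM2l _ IH); last lra.
have -> : (1 + x) * (1 + x *+ m) = 1 + x *+ m.+1 + x ^+ 2 *+ m.
  by rewrite mulrSr -[x *+ m]mulr_natr -[x ^+ 2 *+ m]mulr_natr; ring.
by rewrite lerDl mulrn_wge0 ?sqr_ge0.
Qed.

(* With p positive and q negative signs, p - q >= L and p + q <= r L give
   (1 + t)^p (1 - t)^q >= ((1 - t^2)^r (1 + t))^L, and t = 1/(4 r) makes the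
   base at least 1 + 1/(8 r). *)
Lemma prod_signs_large (r l : nat) D (u : T -> bool) :
  (0 < r)%N -> (#|D| <= r * (8 * r * l))%N ->
  (8 * r * l)%:R <= \sum_(x in D) (-1) ^+ u x :> R ->
  2 ^+ l <= \prod_(x in D) (1 + (4 * r%:R)^-1 * (-1) ^+ u x) :> R.
Proof.
move=> r_gt0 leD; rewrite sum_signs prod_signs.
set p := #|[set x in D | ~~ u x]|; set q := #|[set x in D | u x]|.
rewrite lerBrDr -natrD ler_nat => lepq.
set L := (8 * r * l)%N in leD lepq *.
have leqL : (q <= r * L)%N.
  apply: leq_trans leD; apply: subset_leq_card.
  by apply/subsetP => x; rewrite inE => /andP[].
have r1 : 1 <= r%:R :> R by rewrite ler1n.
set t := (4 * r%:R)^-1 : R.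
have tr : t * (4 * r%:R) = 1 by rewrite /t mulVf //; lra.
have t0 : 0 < t by rewrite invr_gt0; lra.
have t1 : t <= 4^-1 by nra.
have step1 : (1 - t ^+ 2) ^+ q * (1 + t) ^+ L <= (1 + t) ^+ p * (1 - t) ^+ q.
  have -> : 1 - t ^+ 2 = (1 + t) * (1 - t) by ring.
  rewrite exprMn -mulrA [_ ^+ q * _ ^+ L]mulrC mulrA -exprD.
  apply: ler_wpM2r; first by apply: exprn_ge0; lra.
  by apply: ler_weXn2l; [lra | rewrite addnC].
apply: le_trans step1.
have step2 : ((1 - t ^+ 2) ^+ r * (1 + t)) ^+ L
    <= (1 - t ^+ 2) ^+ q * (1 + t) ^+ L.
  rewrite exprMn -exprM; apply: ler_wpM2r; first by apply: exprn_ge0; lra.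
  by apply: ler_wiXn2l => //; nra.
apply: le_trans step2.
(* As [4 * r * t = 1], Bernoulli bounds the power below by [1 - r t^2 = 1 - t / 4], and
   [(1 - t / 4) (1 + t) >= 1 + t / 2] for [t <= 1]. *)
have base : 1 + (8 * r%:R)^-1 <= (1 - t ^+ 2) ^+ r * (1 + t).
  have -> : (8 * r%:R)^-1 = t / 2 by rewrite /t; field; lra.
  have B : 1 + - t ^+ 2 * r%:R <= (1 - t ^+ 2) ^+ r.
    by rewrite mulr_natr; apply: bernoulli; nra.
  apply: le_trans (ler_wpM2r _ B); last lra.
  have -> : - t ^+ 2 * r%:R = - (t / 4) * (t * (4 * r%:R)) by field.
  rewrite tr; nra.
have i0 : 0 < (8 * r%:R)^-1 :> R by rewrite invr_gt0; lra.
(* Bernoulli again: [8 * r] copies of the base give a factor 2, which explains the multiple of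
   [8 * r] in [L]. *)
have two : 2 <= ((1 - t ^+ 2) ^+ r * (1 + t)) ^+ (8 * r).
  apply: le_trans (_ : (1 + (8 * r%:R)^-1) ^+ (8 * r) <= _).
    apply: le_trans (bernoulli _ _ _); last lra.
    by rewrite -[_ *+ (8 * r)]mulr_natr natrM mulVf; lra.
  by apply: lerXn2r => //; rewrite nnegrE; lra.
rewrite /L exprM; apply: lerXn2r => //; rewrite nnegrE; lra.
Qed.

(* If every sign pattern failed some test i, the product of test i would be at
   least 2^(l i) > #|I| there, while these products average to 1. *)
Lemma exists_good_signs (I : finType) (D : I -> {set T})
    (g : I -> {ffun T -> bool} -> T -> bool) (good : pred I)
    (r : nat) (l : I -> nat) :
  (0 < r)%N ->
  (forall i, {in D i, forall x0 f, {in D i, g i (flip x0 f) =1 g i f}}) ->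
  (forall i, good i -> #|D i| <= r * (8 * r * l i))%N ->
  (forall i, good i -> #|I| < 2 ^ l i)%N ->
  exists f, forall i, good i ->
    \sum_(x in D i) (-1) ^+ (f x (+) g i f x) < (8 * r * l i)%:R :> R.
Proof.
move=> r_gt0 gD leD ltI.
pose P i f : R :=
  \prod_(x in D i) (1 + (4 * r%:R)^-1 * (-1) ^+ (f x (+) g i f x)).
have r1 : 1 <= r%:R :> R by rewrite ler1n.
have P0 i f : 0 <= P i f.
  apply: prodr_ge0 => x _.
  have t0 : 0 <= (4 * r%:R)^-1 :> R by rewrite invr_ge0; lra.
  have t1 : (4 * r%:R)^-1 <= 1 :> R by rewrite invf_le1; lra.
  by case: (_ (+) _); rewrite ?expr1 ?expr0; lra.
pose ok f i := good i ==>
  (\sum_(x in D i) (-1) ^+ (f x (+) g i f x) < (8 * r * l i)%:R :> R).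
case: (boolP [exists f, forall i, ok f i]) => [/existsP[f /forallP okf]|].
  by exists f => i gi; move/implyP: (okf i); apply.
rewrite negb_exists => /forallP bad; exfalso.
have low f : #|I|.+1%:R <= \sum_i P i f.
  have := bad f; rewrite negb_forall => /existsP[i].
  rewrite negb_imply -leNgt => /andP[gi big].
  rewrite (bigD1 i) //=; apply: ler_wpDr; first exact: sumr_ge0.
  apply: le_trans (prod_signs_large _ _ _ _ r_gt0 (leD _ gi) big).
  by rewrite -natrX ler_nat ltI.
have : \sum_(f : {ffun T -> bool}) (#|I|.+1%:R : R) <= \sum_(f : {ffun T -> bool}) \sum_i P i f.
  by apply: ler_sum => f _.
rewrite exchange_big /=.
under [X in _ <= X]eq_bigr => i _ do rewrite (sum_prod_signs _ _ _ (gD i)).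
rewrite !sumr_const -!mulrnA ler_nat cardT.
rewrite mulnC leq_pmul2l ?ltnn //.
by apply/card_gt0P; exists [ffun=> false].
Qed.

End RandomSigns.

(** * Affine maps and subspaces as a finite family of tests *)

Section AffineTests.
Variables (R : realType) (n : nat).
Local Notation T := 'cV['F_2]_n.
Implicit Types (a b x : T) (M W : 'M['F_2]_n) (phi : 'rV['F_2]_n).

(* [b] lies outside the column space of [M + 1], so some functional [phi] kills
   this column space but not [b]; then [phi (M x + b) = phi x + 1] for all x. *)
Lemma fixpoint_free_functional M b : (forall x, M *m x + b <> x) ->
  exists phi, forall x, phi *m (M *m x + b) != phi *m x.
Proof.
move=> nofix; pose N := (M - 1%:M)^T.
(* If [b = (M - 1) y], then [- y] is a fixed point. *)
have : ~~ (b^T <= N)%MS.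
  apply/negP => /submxP[D bE]; apply: (nofix (- D^T)).
  have -> : b = (M - 1%:M) *m D^T by rewrite -[LHS]trmxK bE trmx_mul trmxK.
  by rewrite mulmxBl mul1mx mulmxN addrA addNr add0r.
rewrite submxE => /eqP bN.
have [j bj] : exists j, (b^T *m cokermx N) 0 j != 0.
  apply/existsP; apply: contra_notT bN => /existsPn bN.
  by apply/rowP => j; rewrite [RHS]mxE; apply/eqP; have := bN j; rewrite negbK.
(* A column of the cokernel kills the image of [M - 1]; column [j] is one that does not kill [b]. *)
exists (row j (cokermx N)^T) => x.
rewrite -subr_eq0 -mulmxBr addrAC -{2}[x]mul1mx -mulmxBl mulmxDr.
have -> : row j (cokermx N)^T *m ((M - 1%:M) *m x) = 0.
  by rewrite mulmxA -row_mul -[M - 1%:M]trmxK -trmx_mul mulmx_coker trmx0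
             row0 mul0mx.
rewrite add0r -[b]trmxK -row_mul -trmx_mul.
apply: contraNneq bj => /rowP/(_ 0); rewrite [LHS]mxE [LHS]mxE => ->.
by rewrite mxE.
Qed.

(** The matrix of the projection onto [V] has image [V]. Encoding subspaces by matrices makes the
    tests easy to count. *)
Lemma affine_subspace_mx a (V : {vspace T}) :
  exists W, affine_subspace a V = [set a + W *m v | v : T].
Proof.
pose W := \matrix_(i, j) (projv V (delta_mx j 0)) i 0 : 'M['F_2]_n.
have WE v : W *m v = projv V v.
  rewrite {2}[v]matrix_sum_delta linear_sum; apply/colP => i.
  rewrite mxE summxE; apply: eq_bigr => j _.
  by rewrite big_ord1 linearZ !mxE mulrC.
exists W; apply/setP => x; apply/imsetP/imsetP => -[v Vv ->].
  by exists v => //; rewrite WE projv_id.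
by exists (projv V v); rewrite ?memv_proj ?WE.
Qed.

Lemma card_affine_subspace a (V : {vspace T}) :
  #|affine_subspace a V| = (2 ^ \dim V)%N.
Proof.
rewrite card_imset; last exact: addrI.
by rewrite card_vspace card_Fp.
Qed.

(* When [phi] does not separate [M x + b] from [x] (in particular for
   [phi = 0]), the second factor is dropped. *)
Definition affine_bias (f : {ffun T -> bool}) (S : {set T}) M b phi
    (tau : 'M['F_2]_1) : R :=
  \sum_(x in S | phi *m x == tau)
    (-1) ^+ (f x (+) ((phi *m (M *m x + b) != phi *m x) && f (M *m x + b))).

Lemma exists_small_affine_bias (r : nat) :
  (0 < r)%N -> (8 * r ^ 2 <= n)%N ->
  exists f, forall W a, let S := [set a + W *m v | v : T] in
    (8 * r ^ 2 %| #|S|)%N -> (n ^ 4 <= #|S|)%N ->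
    forall M b phi tau, `|affine_bias f S M b phi tau| <= #|S|%:R / r%:R.
Proof.
move=> r_gt0 r_le.
(* The final bit negates the sum, so that one-sided bounds control the absolute value. *)
pose I := ('M['F_2]_n * T * 'M['F_2]_n * T * 'rV['F_2]_n * 'M['F_2]_1
           * bool)%type.
pose iS (i : I) := let: (W, a, M, b, phi, tau, s) := i in
  [set a + W *m v | v : T].
pose D (i : I) := let: (W, a, M, b, phi, tau, s) := i in
  [set x in iS i | phi *m x == tau].
pose g (i : I) (f : {ffun T -> bool}) x := let: (W, a, M, b, phi, tau, s) := i in
  s (+) ((phi *m (M *m x + b) != phi *m x) && f (M *m x + b)).
pose good (i : I) := (8 * r ^ 2 %| #|iS i|)%N && (n ^ 4 <= #|iS i|)%N.
(* By divisibility, the threshold [8 * r * l i] is exactly [#|S| / r] for good tests. *)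
pose l i := (#|iS i| %/ (8 * r ^ 2))%N.
have lE i : good i -> (r * (8 * r * l i) = #|iS i|)%N.
  by move=> /andP[/divnK <- _]; rewrite -/(l i); ring.
have cardI : #|{: I}| = (2 ^ (2 * n ^ 2 + 3 * n + 2))%N.
  rewrite !card_prod !card_mx card_bool card_Fp // -!expnD -expnSr.
  by congr (2 ^ _)%N; ring.
have [|||f fP] := @exists_good_signs R T I D g good r l r_gt0.
(* The second factor occurs only when [phi] separates [M x + b] from [x]; then [M x + b] is outside
   the half containing [x0], so the flip does not reach it. *)
- move=> [[[[[[W a] M] b] phi] tau] s] x0 /= + f x; rewrite !inE.
  move=> /andP[_ /eqP x0E] /andP[_ /eqP xE].
  case: eqP => //= neq; rewrite ffunE.
  case: eqP => [Ax|]; last by rewrite addbF.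
  by case: neq; rewrite Ax x0E xE.
- move=> i gi; rewrite lE //; apply: subset_leq_card.
  move: i {gi} => [[[[[[W a] M] b] phi] tau] s].
  by apply/subsetP => x; rewrite inE => /andP[].
- move=> i gi; rewrite cardI ltn_exp2l //.
  have /andP[_ Sn] := gi; rewrite -lE // in Sn.
  have r1 : (8 <= 8 * r ^ 2)%N by rewrite leq_pmulr // expn_gt0 r_gt0.
  have n8 := leq_trans r1 r_le.
  (* Hence [l i >= n^3], which exceeds the exponent [2 n^2 + 3 n + 2] because [n >= 8]. *)
  have : (n ^ 4 <= n * l i)%N.
    apply: leq_trans Sn _.
    have -> : (r * (8 * r * l i) = 8 * r ^ 2 * l i)%N by ring.
    by rewrite leq_mul2r r_le orbT.
  rewrite expnS leq_pmul2l; last lia.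
  by apply: leq_trans; rewrite !expnS expn0; nia.
exists f => W a S dvS leS M b phi tau.
have le_s (s : bool) : (-1) ^+ s * affine_bias f S M b phi tau <= #|S|%:R / r%:R.
  have gi : good (W, a, M, b, phi, tau, s) by apply/andP.
  have rr : 0 < r%:R :> R by rewrite ltr0n.
  rewrite ler_pdivlMr // -(lE _ gi) natrM mulrC ler_pM2l //.
  apply: le_trans (ltW (fP _ gi)); rewrite mulr_sumr.
  rewrite le_eqVlt; apply/orP; left; apply/eqP.
  apply: eq_big => x; first by rewrite !inE.
  by move=> _; rewrite /g -signr_addb addbCA.
rewrite ler_norml; have := le_s false; have := le_s true.
by rewrite /= expr0 expr1; lra.
Qed.

End AffineTests.

(** * The XOR lemma for two output bits *)

Section StatisticalDistance.
Variables (R : realType) (T : finType) (P : dist R T).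
Variables (f : {ffun T -> bool}) (A : T -> T).

(** Each bit indicator is [(1 + sign) / 2]. In the difference of the two mass functions the constant
    and the mean sign of [f (A x)] cancel, leaving a quarter of a signed sum of the two biases. Each
    of the four points thus contributes at most [delta / 2]. *)
Lemma stat_dist_le_bias (delta : R) :
  `|\sum_x P x * (-1) ^+ f x| + `|\sum_x P x * (-1) ^+ (f x (+) f (A x))|
    <= 2 * delta ->
  stat_dist
    (dmap (fun x => ((f x)%:R : 'F_2, (f (A x))%:R : 'F_2)) P)
    (dmap (fun ux : 'F_2 * T => (ux.1, (f (A ux.2))%:R : 'F_2))
       (dprod (unif_bit R) P)) <= delta.
Proof.
set E1 := \sum_x _; set E2 := \sum_x _ => leE.
have bitE (y : bool) (b : 'F_2) :
    (((y%:R : 'F_2) == b)%:R : R) = (1 + (-1) ^+ (y (+) (b != 0))) / 2.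
  by case: b => -[|[|[]]] //= ?; case: y;
     rewrite /= ?expr0 ?expr1 /eq_op /=; field.
rewrite /stat_dist.
have le_bc (z : 'F_2 * 'F_2) :
  `|dmap (fun x => ((f x)%:R : 'F_2, (f (A x))%:R : 'F_2)) P z
    - dmap (fun ux : 'F_2 * T => (ux.1, (f (A ux.2))%:R : 'F_2))
       (dprod (unif_bit R) P) z| <= delta / 2.
  case: z => b c; rewrite /= /dmap_pmf /=.
  have -> : \sum_(x : 'F_2 * T | (x.1, (f (A x.2))%:R : 'F_2) == (b, c))
      dprod_pmf (unif_bit R) P x =
      \sum_x P x * 2^-1 * (((f (A x))%:R : 'F_2) == c)%:R.
    rewrite big_mkcond /= -(pair_bigA _ (fun u x => if (u, (f (A x))%:R : 'F_2)
      == (b, c) then dprod_pmf (unif_bit R) P (u, x) else 0)) /=.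
    rewrite (bigD1 b) //= [X in _ + X]big1 ?addr0; last first.
      by move=> u /negbTE ub; apply: big1 => x _; rewrite xpair_eqE ub.
    apply: eq_bigr => x _; rewrite xpair_eqE eqxx /= /dprod_pmf /= /unif_bit_pmf.
    by case: eqP => _; rewrite ?mulr1 ?mulr0 // mulrC.
  have -> : \sum_(x | ((f x)%:R : 'F_2, (f (A x))%:R : 'F_2) == (b, c)) P x =
      \sum_x P x * (((f x)%:R : 'F_2) == b)%:R * (((f (A x))%:R : 'F_2) == c)%:R.
    rewrite big_mkcond /=; apply: eq_bigr => x _; rewrite xpair_eqE.
    by case: eqP => _; case: eqP => _; rewrite ?mulr1 ?mulr0.
  rewrite -sumrB.
  have -> : \sum_x (P x * (((f x)%:R : 'F_2) == b)%:R * (((f (A x))%:R : 'F_2) == c)%:R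
       - P x * 2^-1 * (((f (A x))%:R : 'F_2) == c)%:R) =
     4^-1 * ((-1) ^+ (b != 0) * E1 + (-1) ^+ ((b != 0) (+) (c != 0)) * E2).
    rewrite mulrDr !mulr_sumr -big_split /=; apply: eq_bigr => x _.
    by rewrite !bitE !signr_addb; field.
  rewrite normrM ger0_norm ?invr_ge0 //.
  have := ler_normD ((-1) ^+ (b != 0) * E1) ((-1) ^+ ((b != 0) (+) (c != 0)) * E2).
  by rewrite !normrM !normr_sign !mul1r; lra.
apply: le_trans (_ : 2^-1 * \sum_(z : 'F_2 * 'F_2) (delta / 2) <= _).
  by apply: ler_wpM2l; [lra | apply: ler_sum].
by rewrite sumr_const card_prod card_Fp // -[_ *+ _]mulr_natr; lra.
Qed.

End StatisticalDistance.

(** * Choice of parameters and conclusion *)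

Lemma exists_pow2_inv_le (R : realType) (eps : R) : 0 < eps ->
  exists s : nat, 2 / (2 ^ s)%:R <= eps.
Proof.
move=> e0; exists (Num.bound (2 / eps)).
have e2 : 0 <= 2 / eps by rewrite divr_ge0 // ltW.
have := archi_boundP e2; set s := Num.bound _ => lts.
rewrite ler_pdivrMr ?ltr0n ?expn_gt0 // mulrC -ler_pdivrMr //.
by apply: le_trans (ltW lts) _; rewrite ler_nat ltnW // ltn_expl.
Qed.

Lemma log2_le_natr (R : realType) (m n k : nat) : (0 < n)%N ->
  m%:R * log2 (n%:R : R) <= k%:R -> (n ^ m <= 2 ^ k)%N.
Proof.
move=> n0; have l2 : 0 < ln (2 : R) by apply: ln_gt0; lra.
rewrite /log2 mulrA ler_pdivrMr // !mulr_natl -!lnXn ?ltr0n //.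
by rewrite ler_ln ?posrE ?exprn_gt0 ?ltr0n // -!natrX ler_nat.
Qed.

Theorem theorem6p3 (R : realType) (eps : R) (eps_gt0 : 0 < eps) :
  exists c : R, 1 < c /\
  exists N : nat, forall n : nat, (N <= n)%N ->
  exists anmExt : 'cV['F_2]_n -> 'F_2,
  forall k : nat, c * log2 (n%:R : R) <= k%:R ->
  forall (X : dist R 'cV['F_2]_n) (d : nat), affine_source X d -> (k <= d)%N ->
  forall A : 'cV['F_2]_n -> 'cV['F_2]_n,
    affine_fun A -> (forall x, A x <> x) ->
  stat_dist
    (dmap (fun x => (anmExt x, anmExt (A x))) X)
    (dmap (fun ux : 'F_2 * 'cV['F_2]_n => (ux.1, anmExt (A ux.2)))
       (dprod (unif_bit R) X)) <= eps.
Proof.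
(* The constant 4 turns the entropy bound into a support of size at least [n^4]; only the threshold
   on [n] depends on [eps]. *)
exists 4%:R; split; first by rewrite ltr1n.
(* Taking [r = 2 ^ s] lets [8 * r ^ 2] divide the support size [2 ^ d]. *)
have [s le_s] := exists_pow2_inv_le _ _ eps_gt0.
exists (8 * (2 ^ s) ^ 2)%N => n len.
have r_gt0 : (0 < 2 ^ s)%N by rewrite expn_gt0.
have n_gt0 : (0 < n)%N by apply: leq_trans len; rewrite muln_gt0 expn_gt0 r_gt0.
have [f fP] := @exists_small_affine_bias R n _ r_gt0 len.
exists (fun x => (f x)%:R) => k /(@log2_le_natr _ 4 _ _ n_gt0) le_k X d.
move=> [a [V [dimV XE]]] le_kd A [M [b AE]] nofix.
have [phi phiA] : exists phi : 'rV_n, forall x, phi *m (M *m x + b) != phi *m x.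
  by apply: fixpoint_free_functional => x; rewrite -AE.
have cardS := card_affine_subspace _ a V.
have [W SE] := affine_subspace_mx _ a V.
have n4 : (n ^ 4 <= 2 ^ d)%N.
  by apply: leq_trans le_k _; rewrite leq_exp2l.
have {}fP : forall N c psi tau,
    `|affine_bias R n f (affine_subspace a V) N c psi tau| <= (2 ^ d)%:R / (2 ^ s)%:R.
  rewrite -dimV -cardS SE; apply: fP; rewrite -SE cardS dimV //.
  have -> : (8 * (2 ^ s) ^ 2 = 2 ^ (2 * s + 3))%N.
    by rewrite -expnM -[8%N]/(2 ^ 3)%N -expnD; congr (2 ^ _)%N; ring.
  apply: dvdn_exp2l; rewrite -(@leq_exp2l 2) //.
  apply: leq_trans n4; apply: leq_trans (leq_trans len _); last first.
    by rewrite -{1}[n]expn1 leq_pexp2l.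
  by rewrite -expnM -[8%N]/(2 ^ 3)%N -expnD leq_exp2l //; lia.
set S := affine_subspace a V in XE cardS fP.
have meanE (F : 'cV['F_2]_n -> R) :
    \sum_x X x * F x = (2 ^ d)%:R^-1 * \sum_(x in S) F x.
  rewrite mulr_sumr [RHS]big_mkcond; apply: eq_bigr => x _.
  by rewrite XE cardS dimV; case: ifP; rewrite ?mul0r.
have q0 : 0 < (2 ^ d)%:R :> R by rewrite ltr0n expn_gt0.
have mean_le (z y : R) : `|z| <= (2 ^ d)%:R * y -> `|(2 ^ d)%:R^-1 * z| <= y.
  by move=> ?; rewrite normrM ger0_norm ?invr_ge0 // mulrC ler_pdivrMr // mulrC.
apply: stat_dist_le_bias; rewrite !meanE.
(* The sign of [f] costs [1 / r], and the product sign costs [1 / r] on each half;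
   [3 / r <= 2 * eps]. *)
apply: le_trans (_ : (2 ^ s)%:R^-1 + (2 * (2 ^ s)%:R^-1) <= _); last first.
  have : 0 <= (2 ^ s)%:R^-1 :> R by rewrite invr_ge0.
  by move: le_s; lra.
apply: lerD; apply: mean_le.
  (* The zero functional selects all of [S] and drops the second factor. *)
  have := fP 0 0 0 0; rewrite /affine_bias.
  under eq_bigr => x _ do rewrite !mul0mx eqxx addbF.
  by under eq_bigl => x do rewrite mul0mx eqxx andbT.
have split01 (z : 'M['F_2]_1) : (z != 0) = (z == 1%:M).
  rewrite [z]mx11_scalar.
  have [->|->] : z 0 0 = 0 \/ z 0 0 = 1.
    by case: (z 0 0) => -[|[|[]]] // ?; [left | right]; apply: val_inj.
  - by rewrite raddf0 eqxx eq_sym (oner_eq0 'M['F_2]_1).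
  - by rewrite eqxx (oner_eq0 'M['F_2]_1).
rewrite (bigID (fun x => phi *m x == 0)) /=.
(* Here [phi] separates every [x] from [A x], so the test retains the whole product sign. *)
have half tau : `|\sum_(x in S | phi *m x == tau) (-1) ^+ (f x (+) f (A x))|
    <= (2 ^ d)%:R / (2 ^ s)%:R :> R.
  have := fP M b phi tau; rewrite /affine_bias.
  by under eq_bigr => x _ do rewrite phiA -AE.
have half1 := half 1%:M.
under [X in `|_ + X|]eq_bigl => x do rewrite split01.
apply: le_trans (ler_normD _ _) _.
by have := half 0; lra.
Qed.
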